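(* Let $r\ge 2$ be an integer, let $G\in\mathcal{M}_{1/r}(\mathcal{C})$ be such that $r$ divides $v(G)$, and let $G^+$ denote a $2$-connected graph obtained from $G$ by blowing up an arbitrary vertex to an induced cycle $C$ of length $r+1$. Then $G^+\in\mathcal{M}_{1/r}(\mathcal{C})$.
   Context: All graphs are finite and simple; $v(G)$ and $e(G)$ denote the numbers of vertices and edges of $G$. For an integer $r\ge2$, $\mathcal{R}_{1/r}(\mathcal{C})$ denotes the class of graphs $G$ such that every colouring of $E(G)$ with $r+1$ colours admits a cycle in $G$ (of arbitrary length) whose edges use at most $r$ of the colours. $\mathcal{M}_{1/r}(\mathcal{C})$ is the class of those $G\in\mathcal{R}_{1/r}(\mathcal{C})$ that are minimal with respect to the subgraph relation, i.e. no proper subgraph of $G$ belongs to $\mathcal{R}_{1/r}(\mathcal{C})$. Blowing up a vertex $x$ of $G$ to an induced cycle $C$ of length $r+1$ is the reverse of contracting $C$ to $x$: delete $x$, add a new cycle $C$ on $r+1$ new vertices, and replace each edge $xy$ of $G$ by exactly one edge from $y$ to some (arbitrarily chosen) vertex of $C$, with no further edges added; so $v(G^+)=v(G)+r$ and $e(G^+)=e(G)+r+1$. *)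

(* Defs.v *)
From HB Require Import structures.
From mathcomp Require Import all_boot.

Set Implicit Arguments.
Unset Strict Implicit.
Unset Printing Implicit Defensive.

(* A finite simple graph is a pair (V, E) with V a subset of an ambient finite
   type T and E a set of 2-element subsets of V; the elements of T outside V
   play no role.  Subgraphs of G then live in the same type [graph T]. *)
Record graph (T : finType) := Graph {
  vset : {set T};
  eset : {set {set T}};
  esetP : eset \subset [set e in powerset vset | #|e| == 2]
}.

Section Graphs.
Variable T : finType.
Implicit Types (G H : graph T) (X : {set T}) (p : seq T).

Definition adj G : rel T := fun u v => [set u; v] \in eset G.

Definition subgraph H G : bool :=
  (vset H \subset vset G) && (eset H \subset eset G).

Definition proper_subgraph H G : bool := subgraph H G && ~~ subgraph G H.

Fact del_vertices_esetP G X :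
  [set e in eset G | e \subset vset G :\: X]
    \subset [set e in powerset (vset G :\: X) | #|e| == 2].
Proof.
apply/subsetP=> e; rewrite !inE => /andP[eG ->] /=.
by have /subsetP/(_ e eG) := esetP G; rewrite inE => /andP[].
Qed.

Definition del_vertices G X : graph T := Graph (del_vertices_esetP G X).

Definition connected G : Prop :=
  vset G != set0 /\ {in vset G &, forall u v, connect (adj G) u v}.

Definition k_connected (k : nat) G : Prop :=
  k < #|vset G| /\ forall X, #|X| < k -> connected (del_vertices G X).

(* A cycle is listed by its vertices, in cyclic order. *)
Definition is_cycle G p : bool := (2 < size p) && ucycleb (adj G) p.

(* Only the values of a colouring [f] on the edges of the graph at hand matter;
   it is defined on all subsets of T merely to have a simple type. *)
Definition cycle_colours (C : finType) (f : {set T} -> C) p : {set C} :=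
  [set f [set u; next p u] | u in p].

(* R_{1/r}(C), with C the family of all cycles *)
Definition in_R (r : nat) G : Prop :=
  forall f : {set T} -> 'I_r.+1,
    exists2 p, is_cycle G p & #|cycle_colours f p| <= r.

(* M_{1/r}(C): the members of R_{1/r}(C) minimal for the subgraph relation *)
Definition in_M (r : nat) G : Prop :=
  in_R r G /\ forall H, proper_subgraph H G -> ~ in_R r H.

End Graphs.

(* Blowing up x to a cycle of length r+1: the new vertices are the [inr i] with
   i : 'I_r.+1, in this cyclic order, and the edge joining x to a neighbour y is
   replaced by the edge joining y to [inr (att y)]; [att] is only used at
   neighbours of x.  The condition [i != ordS i], always true for 0 < r, only
   serves to exclude a loop when r = 0. *)
Section Blowup.
Variables (T : finType) (r : nat) (G : graph T) (x : T) (att : T -> 'I_r.+1).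

Definition blowup_vset : {set T + 'I_r.+1} :=
  inl @: (vset G :\ x) :|: inr @: [set: 'I_r.+1].

Definition blowup_eset : {set {set T + 'I_r.+1}} :=
  [set [set inl u | u in e] | e : {set T} in eset G & x \notin e]
  :|: [set [set inl y; inr (att y)] | y : T & adj G x y]
  :|: [set [set inr i; inr (ordS i)] | i : 'I_r.+1 & i != ordS i].

Fact blowup_esetP :
  blowup_eset \subset [set e in powerset blowup_vset | #|e| == 2].
Proof.
have eG (e : {set T}) : e \in eset G -> e \subset vset G /\ #|e| = 2.
  have /subsetP sG := esetP G => /sG; rewrite !inE => /andP[eV /eqP e2].
  by split.
apply/subsetP=> a; rewrite 2!in_setU !inE => /orP[/orP[]|] /imsetP[].
- move=> e; rewrite !inE => /andP[/eG[eV e2] xe] ->.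
  rewrite card_imset ?e2 ?eqxx ?andbT; last exact: inl_inj.
  by rewrite (subset_trans _ (subsetUl _ _)) // imsetS // subsetD1 eV.
- move=> y; rewrite !inE /adj => /eG[xyV xy2] ->.
  rewrite cards2 eqxx andbT subUset !sub1set !inE.
  rewrite !mem_imset ?inE ?orbT ?andbT; try exact: inl_inj.
    by move: xyV xy2; rewrite subUset !sub1set cards2 eq_sym => /andP[_ ->]; case: eqP.
  by exact: inr_inj.
- move=> i; rewrite !inE => ii ->.
  rewrite cards2 (inj_eq (@inr_inj _ _)) ii eqxx andbT.
  by rewrite subUset !sub1set !inE !mem_imset ?inE ?orbT //; exact: inr_inj.
Qed.

Definition blowup : graph (T + 'I_r.+1)%type := Graph blowup_esetP.

End Blowup.

(* Main.v *)
Require Import Defs.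
From HB Require Import structures.
From mathcomp Require Import all_boot all_algebra.
From mathcomp Require Import zify.

(* A colouring in which every cycle sees all r+1 colours is the same as a cover of
   the edges by r+1 forests (the complements of the colour classes) using every
   edge exactly r times.  By Nash-Williams' theorem such a colouring exists iff
   r |D| <= (r+1) rk D for every edge set D, rk being the graphic rank.
   So G in M_{1/r}(C) satisfies this for all proper D but not for D = E(G); being
   connected, with r dividing v(G), it has r e(G) = (r+1)(v(G)-1) + 1 exactly.
   Blowing up x adds r(r+1) to both sides, so G^+ is in R_{1/r}(C).  For a proper D
   contract C: if D misses an edge of G, the bound for G carries over; otherwise D
   misses an edge of C, and each edge of C in D gains 1.  If there is none,
   D = E(G) joins two vertices of C by 2-connectedness, which raises its rank by 1.

   Ranks are dimensions of spans of incidence vectors over F_2. *)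

Set Implicit Arguments.
Unset Strict Implicit.
Unset Printing Implicit Defensive.

Import GRing.Theory.

(** * Spans and linear independence of a family of vectors *)

Section Span.
Variables (K : fieldType) (vT : vectType K) (S : finType) (vec : S -> vT).
Implicit Types (A B D : {set S}) (e : S) (U : {vspace vT}).

Definition sp A : {vspace vT} := (\sum_(e in A) <[vec e]>)%VS.

Definition indep A : bool := \dim (sp A) == #|A|.

Lemma sp_subP A U : reflect (forall e, e \in A -> vec e \in U) (sp A <= U)%VS.
Proof. by apply: (iffP subv_sumP) => H e /H; rewrite memvE. Qed.

Lemma mem_sp A e : e \in A -> vec e \in sp A.
Proof. by move: e; apply/sp_subP. Qed.

Lemma spS A B : A \subset B -> (sp A <= sp B)%VS.
Proof. by move=> /subsetP AB; apply/sp_subP => e /AB; apply: mem_sp. Qed.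

Lemma spU A B : sp (A :|: B) = (sp A + sp B)%VS.
Proof.
apply/eqP; rewrite eqEsubv subv_add !spS ?subsetUl ?subsetUr // !andbT.
apply/sp_subP => e; rewrite inE => /orP[] /mem_sp; apply: subvP.
  exact: addvSl.
exact: addvSr.
Qed.

Lemma sp1 e : sp [set e] = <[vec e]>%VS.
Proof. by rewrite /sp big_set1. Qed.

Lemma dim_sp A : \dim (sp A) <= #|A|.
Proof.
rewrite -sum1_card (leq_trans (dimv_leq_sum _ _ _)) //.
by apply: leq_sum => e _; rewrite dim_vline; case: eqP.
Qed.

Lemma dim_sp_sub A B : \dim (sp B) <= \dim (sp A) + #|B :\: A|.
Proof.
have BA : B \subset A :|: (B :\: A) by apply/subsetP => e; rewrite !inE; case: (e \in A).
apply: leq_trans (dimvS (spS BA)) _; rewrite spU.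
by apply: leq_trans (dimv_add_leqif _ _).1 _; rewrite leq_add2l dim_sp.
Qed.

Lemma indepS A B : A \subset B -> indep B -> indep A.
Proof.
move=> AB /eqP iB; have := dim_sp_sub A B; have := dim_sp A.
rewrite /indep iB cardsDS //; have := subset_leq_card AB; lia.
Qed.

Lemma dim_addv_line U v : v \notin U -> \dim (<[v]> + U) = (\dim U).+1.
Proof.
move=> vU; have v0 : v != 0%R by apply: contraNneq vU => ->; rewrite mem0v.
rewrite dimv_disjoint_sum; first by rewrite dim_vline v0.
apply/eqP; rewrite -subv0; apply/subvP => w; rewrite memv_cap memv0.
case/andP=> /vlineP[k ->] kvU; rewrite scaler_eq0; apply/orP; left.
apply: contraNT vU => k0.
by rewrite -[v](scalerK (a := k)) ?unitfE // memvZ.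
Qed.

Lemma indepU1 e A : indep A -> vec e \notin sp A -> indep (e |: A).
Proof.
move=> iA eA; rewrite /indep spU sp1 dim_addv_line // (eqP iA) cardsU1.
by case: (boolP (e \in A)) => // /mem_sp; rewrite (negbTE eA).
Qed.

Lemma indep_notin e A : indep A -> e \in A -> vec e \notin sp (A :\ e).
Proof.
move=> iA eA; apply/negP => H.
have AS : (sp A <= sp (A :\ e))%VS.
  apply/sp_subP => e' e'A; case: (eqVneq e' e) => [-> //|ne].
  by apply: mem_sp; rewrite !inE ne.
have := dimvS AS; rewrite (eqP iA) (eqP (indepS (subD1set A e) iA)).
by rewrite [#|A|](cardsD1 e) eA; lia.
Qed.

(** If no element lay in the span of the others, every subset of [A] could be built one vector at a
    time, always outside the span so far. *)
Lemma dependentP A : ~~ indep A -> exists2 e, e \in A & vec e \in sp (A :\ e).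
Proof.
move=> dA; apply/exists_inP; apply: contraT; rewrite negb_exists_in.
move=> /forall_inP H; case/negP: dA.
suff P n : forall B, #|B| = n -> B \subset A -> indep B by exact: P.
elim: n => [|n IH] B.
  move=> /eqP; rewrite cards_eq0 => /eqP -> _.
  by rewrite /indep /sp big_set0 dimv0 cards0.
move=> Bn BA; have /card_gt0P[e eB] : 0 < #|B| by rewrite Bn.
rewrite -(setD1K eB); apply: indepU1.
  apply: IH; last by apply: subset_trans BA; apply: subD1set.
  by move: Bn; rewrite (cardsD1 e) eB => -[].
apply: contra (H e (subsetP BA e eB)); apply: subvP; apply: spS.
exact: setSD.
Qed.

(* [vec e] lies in the span of its fundamental circuit in [A]. *)
Lemma exchange e A : indep A -> e \notin A -> vec e \in sp A ->
  vec e \in sp [set e' in A | indep (e |: A :\ e')].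
Proof.
move=> iA eA eS.
(* [B] is a minimal subset of [A] whose span contains [vec e]; each of its elements turns out to be
   exchangeable with [e]. *)
have [B /minsetP[/andP[BA eB] minB] _] :
    {B | minset (fun B : {set S} => (B \subset A) && (vec e \in sp B)) B
       & B \subset A}.
  by apply: minset_exists; rewrite subxx.
move: (eB); apply: subvP; apply: spS; apply/subsetP => e' e'B.
have e'A := subsetP BA _ e'B.
rewrite inE e'A /=; apply: indepU1; first exact: indepS (subD1set _ _) iA.
apply/negP => H.
have AB : A = (A :\ e') :|: B.
  apply/eqP; rewrite eqEsubset subUset subD1set BA !andbT.
  by apply/subsetP => z zA; rewrite !inE zA andbT; case: eqVneq => // ->.
(* By dimension, [sp (A :\ e')] meets [sp B] exactly in [sp (B :\ e')], which then contains [vec e],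
   against the minimality of [B]. *)
have := dimv_sum_cap (sp (A :\ e')) (sp B).
rewrite -spU -AB (eqP iA) (eqP (indepS BA iA)).
rewrite (eqP (indepS (subD1set A e') iA)).
move: (cardsD1 e' A) (cardsD1 e' B); rewrite e'A e'B => cA cB ds.
have sub : (sp (B :\ e') <= sp (A :\ e') :&: sp B)%VS.
  by rewrite subv_cap !spS ?setSD ?subD1set.
have /eqP eqs : sp (B :\ e') == (sp (A :\ e') :&: sp B)%VS.
  rewrite eqEdim sub /= (eqP (indepS (subD1set B e') (indepS BA iA))); lia.
have /minB : (B :\ e' \subset A) && (vec e \in sp (B :\ e')).
  by rewrite eqs memv_cap H eB (subset_trans (subD1set _ _) BA).
move=> /(_ (subD1set _ _)) /setP/(_ e').
by rewrite !inE eqxx e'B.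
Qed.

(** * Matroid partition by augmenting swaps *)

Section Covering.
Variables (r : nat) (E : {set S}).
Implicit Types (F : {ffun 'I_r.+1 -> {set S}}) (i : 'I_r.+1).

Definition colourable : Prop :=
  exists f : S -> 'I_r.+1, forall i, indep [set e in E | f e != i].

Definition mult F e : nat := #|[set i | e \in F i]|.

(* Each edge in exactly [r] of the [r.+1] independent sets amounts to a
   colouring: the colour of [e] is the index of the set avoiding [e]. *)
Definition packing F : bool :=
  [forall i, (F i \subset E) && indep (F i)] && [forall e, mult F e <= r].

Definition upd F i A : {ffun 'I_r.+1 -> {set S}} :=
  [ffun j => if j == i then A else F j].

(** An element of multiplicity below [r] replaces [e'] in [F i]. Sizes are preserved, and in a
    packing [e'] falls below [r] in turn, so swaps can be chained. *)
Definition swap F F' : bool :=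
  [exists i, exists e, exists e', [&& e \in E, mult F e < r, e \notin F i,
    e' \in F i, indep (e |: F i :\ e') & F' == upd F i (e |: F i :\ e')]].

Lemma packingP F : reflect
  [/\ forall i, F i \subset E, forall i, indep (F i) & forall e, mult F e <= r]
  (packing F).
Proof.
apply: (iffP andP) => [[/forallP H /forallP H']|[H1 H2 H3]].
  by split=> // i; case/andP: (H i).
by split; apply/forallP => // i; rewrite H1 H2.
Qed.

Lemma packing_upd F i e A : packing F -> e \in E -> mult F e < r ->
  A \subset e |: F i -> indep A -> packing (upd F i A).
Proof.
case/packingP=> FE Fi Fm eE me Ae iA; apply/packingP; split=> [j|j|e'].
- rewrite ffunE; case: eqP => // _; apply: subset_trans Ae _.
  by rewrite subUset sub1set eE FE.
- by rewrite ffunE; case: eqP.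
have [->|ne] := eqVneq e' e.
  apply: leq_trans me; rewrite /mult.
  have /subset_leq_card : [set j | e \in upd F i A j] \subset i |: [set j | e \in F j].
    by apply/subsetP => j; rewrite !inE ffunE; case: eqP.
  by rewrite cardsU1 inE; case: (e \in F i) => /=; lia.
apply: leq_trans (Fm e'); apply: subset_leq_card; apply/subsetP => j.
rewrite !inE ffunE; case: eqP => // -> /(subsetP Ae).
by rewrite !inE (negbTE ne).
Qed.

Lemma swap_packing F F' : packing F -> swap F F' -> packing F'.
Proof.
move=> pF /existsP[i /existsP[e /existsP[e' /and5P[eE me eF e'F]]]].
case/andP=> iF /eqP ->; apply: (packing_upd pF eE me _ iF).
by rewrite setUS // subD1set.
Qed.

Lemma swap_card F F' i : swap F F' -> #|F' i| = #|F i|.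
Proof.
move=> /existsP[j /existsP[e /existsP[e' /and5P[eE me eF e'F]]]].
case/andP=> _ /eqP ->; rewrite ffunE; case: eqP => // ->.
rewrite cardsU1 !inE (negbTE eF) andbF /= [RHS](cardsD1 e') e'F; lia.
Qed.

Lemma sum_card_mult F D :
  \sum_i #|F i :&: D| = \sum_(e in D) mult F e.
Proof.
transitivity (\sum_i \sum_(e in D) (e \in F i : nat)).
  apply: eq_bigr => i _; rewrite -sum1_card -big_mkcondr /=.
  by apply: eq_bigl => e; rewrite inE andbC.
rewrite exchange_big; apply: eq_bigr => e _; rewrite /mult -sum1_card.
by rewrite -big_mkcond /=; apply: eq_bigl => i; rewrite inE.
Qed.

Lemma sum_card_subset F D : (forall i, F i \subset D) ->
  \sum_i #|F i| = \sum_(e in D) mult F e.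
Proof.
move=> FD; rewrite -sum_card_mult; apply: eq_bigr => i _.
by rewrite (setIidPl (FD i)).
Qed.

(** Each element of [D] lies in exactly [r] of the [r.+1] independent sets [F i], whose sizes are at
    most the dimension of the span of [D]. *)
Lemma colourable_bound D : colourable -> D \subset E ->
  r * #|D| <= r.+1 * \dim (sp D).
Proof.
case=> f Hf DE; pose F : {ffun 'I_r.+1 -> {set S}} :=
  [ffun i => [set e in D | f e != i]].
have FD i : F i \subset D by apply/subsetP => e; rewrite ffunE inE => /andP[].
have : \sum_i #|F i| <= \sum_(i < r.+1) \dim (sp D).
  apply: leq_sum => i _; have /eqP <- : indep (F i); last exact/dimvS/spS.
  apply: indepS (Hf i); apply/subsetP => e; rewrite ffunE !inE => /andP[eD ->].
  by rewrite (subsetP DE).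
rewrite sum_nat_const card_ord (sum_card_subset FD); congr (_ <= _).
rewrite mulnC -sum_nat_const; apply: eq_bigr => e eD.
rewrite /mult (_ : [set _ | _] = [set~ f e]) ?cardsC1 ?card_ord //.
by apply/setP => i; rewrite !inE ffunE inE eD eq_sym.
Qed.

Lemma packing_colourable F : packing F ->
  (forall e, e \in E -> mult F e = r) -> colourable.
Proof.
case/packingP=> FE Fi _ mF.
(* As [e] lies in at most [r] of the [r.+1] sets, [pick] succeeds and the default [ord0] is never
   taken. A second set avoiding [e] would bring its multiplicity below [r]. *)
exists (fun e => odflt ord0 [pick i | e \notin F i]) => i.
apply: indepS (Fi i); apply/subsetP => e; rewrite inE => /andP[eE].
case: pickP => [j eFj /= ji|/(_ _)/negbFE H]; last first.
  have := mF e eE; rewrite /mult (_ : [set _ | _] = setT) ?cardsT ?card_ord.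
    by move=> /eqP; rewrite eqn_leq ltnn.
  by apply/setP => k; rewrite !inE H.
apply: contraT => eFi; have := mF e eE; rewrite /mult.
have /subset_leq_card : [set k | e \in F k] \subset [set~ i] :\ j.
  apply/subsetP => k; rewrite !inE => ek.
  by rewrite (contraNneq _ eFj) ?(contraNneq _ eFi) // => <-.
have := cardsC1 i; rewrite (cardsD1 j [set~ i]) !inE ji card_ord; lia.
Qed.

Section Augmenting.
Variable F0 : {ffun 'I_r.+1 -> {set S}}.
Hypothesis F0p : packing F0.
Hypothesis F0max : forall F, packing F -> \sum_i #|F i| <= \sum_i #|F0 i|.

(* When the packing [F0] is maximal, an edge left short of [r] sets by some sequence
   of swaps is spanned by the edges of [F0 i] that are themselves of this kind, for
   every [i]; so these edges violate the bound. *)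
Definition deficient : {set S} :=
  [set e in E | [exists F, connect swap F0 F && (mult F e < r)]].

Lemma reach_packing F : connect swap F0 F ->
  packing F /\ \sum_i #|F i| = \sum_i #|F0 i|.
Proof.
case/connectP=> p; elim/last_ind: p F => [|p F' IH] F /=; first by move=> _ ->.
rewrite rcons_path last_rcons => /andP[/IH{}IH sw] ->.
have [pF sF] := IH _ erefl; split; first exact: swap_packing pF sw.
by rewrite -sF; apply: eq_bigr => i _; apply: swap_card sw.
Qed.

(** For [e] outside [F i], maximality puts [vec e] in the span of [F i]. Swapping [e] for a member
    of its circuit leaves that member short, hence deficient. *)
Lemma deficient_span F e i : connect swap F0 F -> e \in E -> mult F e < r ->
  vec e \in sp (F i :&: deficient).
Proof.
move=> cF eE me; have [pF sF] := reach_packing cF.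
have [FE Fi Fm] := packingP _ pF.
have eD : e \in deficient by rewrite inE eE; apply/existsP; exists F; rewrite cF.
have [eF|eF] := boolP (e \in F i); first by apply: mem_sp; rewrite inE eF.
have eS : vec e \in sp (F i).
  apply: contraT => eS.
  have /F0max : packing (upd F i (e |: F i)).
    by apply: (packing_upd pF eE me) => //; apply: indepU1.
  rewrite -sF (bigD1 i) //= [leqRHS](bigD1 i) //= ffunE eqxx cardsU1 eF.
  rewrite (eq_bigr (fun j => #|F j|)); first by rewrite ltnn.
  by move=> j ji; rewrite ffunE (negbTE ji).
apply: subvP (exchange (Fi i) eF eS); apply: spS; apply/subsetP => e'.
rewrite !inE => /andP[e'F iF]; rewrite e'F (subsetP (FE i)) //=.
apply/existsP; exists (upd F i (e |: F i :\ e')); apply/andP; split.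
  apply: connect_trans cF _; apply: connect1.
  apply/existsP; exists i; apply/existsP; exists e; apply/existsP; exists e'.
  by rewrite eE me eF e'F iF eqxx.
apply: leq_trans (Fm e'); apply: proper_card; apply/properP; split.
  apply/subsetP => j; rewrite !inE ffunE; case: eqP => [->|//].
  by rewrite e'F.
exists i; first by rewrite inE.
rewrite inE ffunE eqxx !inE eqxx orbF.
by apply: contraNneq eF => <-.
Qed.

(** The entering element is already in the span, by [deficient_span]. *)
Lemma swap_span F F' i : connect swap F0 F -> swap F F' ->
  (sp (F' i :&: deficient) <= sp (F i :&: deficient))%VS.
Proof.
move=> cF /existsP[j /existsP[e /existsP[e' /and5P[eE me eF e'F]]]].
case/andP=> _ /eqP ->; rewrite ffunE; case: eqP => [->|_ //].
apply/sp_subP => z; rewrite !inE => /andP[/orP[/eqP -> _|/andP[_ zF] zD]].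
  exact: deficient_span.
by apply: mem_sp; rewrite !inE zF.
Qed.

Lemma reach_span F i : connect swap F0 F ->
  (sp (F i :&: deficient) <= sp (F0 i :&: deficient))%VS.
Proof.
case/connectP=> p; elim/last_ind: p F => [|p F' IH] F /=; first by move=> _ ->.
rewrite rcons_path last_rcons => /andP[pp sw] ->.
apply: subv_trans (IH _ pp erefl); apply: swap_span sw.
by apply/connectP; exists p.
Qed.

Lemma deficient_bound : colourable \/
  exists2 D : {set S}, D \subset E & r.+1 * \dim (sp D) < r * #|D|.
Proof.
have [FE Fi Fm] := packingP _ F0p.
have [/exists_inP[e0 e0E m0]|] := boolP [exists e in E, mult F0 e < r]; last first.
  rewrite negb_exists_in => /forall_inP H; left.
  apply: (packing_colourable F0p) => e /H; rewrite -leqNgt => le.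
  by apply/eqP; rewrite eqn_leq Fm le.
right; exists deficient; first by apply/subsetP => e; rewrite inE => /andP[].
have e0D : e0 \in deficient.
  by rewrite inE e0E; apply/existsP; exists F0; rewrite connect0.
have dimD i : \dim (sp deficient) <= #|F0 i :&: deficient|.
  apply: leq_trans (dim_sp _); apply: dimvS; apply/sp_subP => e.
  rewrite inE => /andP[eE /existsP[F /andP[cF me]]].
  exact: subvP (reach_span i cF) _ (deficient_span i cF eE me).
(* The right side is the total multiplicity in [F0] of the deficient elements, which [e0] keeps
   below [r * #|deficient|]. *)
have : \sum_(i < r.+1) \dim (sp deficient) <= \sum_i #|F0 i :&: deficient|.
  exact: leq_sum.
rewrite sum_nat_const card_ord sum_card_mult => /leq_ltn_trans; apply.
rewrite mulnC -sum_nat_const (bigD1 e0) //= [ltnRHS](bigD1 e0) //=.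
by rewrite -addSn leq_add // leq_sum.
Qed.

End Augmenting.

(* The matroid-partition theorem for [r] copies of [E] and [r.+1] copies of the
   linear matroid of [vec]; for graphic matroids, Nash-Williams' theorem. *)
Lemma colourableP : colourable <->
  forall D : {set S}, D \subset E -> r * #|D| <= r.+1 * \dim (sp D).
Proof.
split=> [cE D|H]; first exact: colourable_bound.
have p0 : packing [ffun => set0].
  apply/packingP; split=> [i|i|e]; rewrite ?ffunE ?sub0set //.
    by rewrite /indep /sp big_set0 dimv0 cards0.
  by rewrite /mult (_ : [set _ | _] = set0) ?cards0 //; apply/setP => i; rewrite !inE ffunE inE.
case: (arg_maxnP (fun F : {ffun 'I_r.+1 -> {set S}} => \sum_i #|F i|) p0).
move=> F pF mF; case: (deficient_bound pF mF) => // -[D /H]; lia.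
Qed.

End Covering.
End Span.

(** * Incidence vectors over F_2: cycles as dependencies *)

Section Incidence.
Variables (T T' : finType) (h : T -> T').
Hypothesis h_inj : injective h.
Local Notation W := {ffun T' -> ('F_2)^o}.
Local Open Scope ring_scope.
Implicit Types (A K : {set {set T}}) (U : {vspace W}).

Definition del (z : T') : W := [ffun z' => (z' == z)%:R].

(** The map [h] places vertices in a possibly larger set, so that edges of two graphs can be
    compared in one space. *)
Definition evec (e : {set T}) : W := \sum_(u in e) del (h u).

Lemma addF2 (w : W) : w + w = 0.
Proof. by apply/ffunP => z; rewrite !ffunE; apply/val_inj; case: (w z) => -[|[|]]. Qed.

Lemma evec2 a b : a != b -> evec [set a; b] = del (h a) + del (h b).
Proof. by move=> ab; rewrite /evec big_setU1 ?inE //= big_set1. Qed.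

Lemma link_trans U a b c :
  del a + del b \in U -> del b + del c \in U -> del a + del c \in U.
Proof.
by move=> ab /(memvD ab); rewrite addrA -(addrA (del a)) addF2 addr0.
Qed.

Lemma sum_del (P : pred T') z : \sum_(y | P y) del z y = (P z)%:R :> 'F_2.
Proof.
rewrite (eq_bigr (fun y => (y == z)%:R : 'F_2)) => [|y _]; last by rewrite ffunE.
case: (boolP (P z)) => Pz.
  rewrite (bigD1 z) //= eqxx big1 ?addr0 // => y /andP[_ /negbTE -> //].
by rewrite big1 // => y Py; case: eqP => // yz; rewrite -yz Py in Pz.
Qed.

Lemma sp_sum0 (S : finType) (vec : S -> W) (P : pred T') (A : {set S}) :
  (forall e, e \in A -> \sum_(y | P y) vec e y = 0) ->
  forall w, w \in sp vec A -> \sum_(y | P y) w y = 0.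
Proof.
move=> H w /memv_sumP[v vA ->].
rewrite (eq_bigr (fun y => \sum_(e in A) v e y)) => [|y _]; last by rewrite sum_ffunE.
rewrite exchange_big big1 // => e eA; have /vlineP[k ->] := vA e eA.
rewrite (eq_bigr (fun y => k * vec e y)) => [|y _]; last by rewrite ffunE.
by rewrite -mulr_sumr H ?mulr0.
Qed.

Section Relation.
Variable K : {set {set T}}.
Hypothesis K2 : forall e, e \in K -> #|e| = 2.

Definition relK : rel T := fun a b => [set a; b] \in K.

Lemma relK_sym : symmetric relK.
Proof. by move=> a b; rewrite /relK setUC. Qed.

Lemma relK_neq a b : relK a b -> a != b.
Proof. by move=> /K2; rewrite cards2; case: eqP. Qed.

Lemma relK_link a b : relK a b -> del (h a) + del (h b) \in sp evec K.
Proof. by move=> ab; rewrite -evec2 ?(relK_neq ab) // mem_sp. Qed.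

Lemma path_link a p : path relK a p -> del (h a) + del (h (last a p)) \in sp evec K.
Proof.
elim: p a => [|b p IH] a /=; first by rewrite addF2 mem0v.
by case/andP=> /relK_link ab /IH; apply: link_trans ab.
Qed.

Lemma link_connect a b : del (h a) + del (h b) \in sp evec K -> connect relK a b.
Proof.
(* [P] is the image of the component of [a]. Each edge of [K] has both ends or neither in it, so
   sums over [P] vanish on the span; hence [b] lies there with [a]. *)
pose P := [pred z | [exists u, (h u == z) && connect relK a u]].
have PE u : P (h u) = connect relK a u.
  apply/existsP/idP => [[v /andP[/eqP/h_inj ->]] //|au]; exists u.
  by rewrite eqxx au.
have cs : connect_sym relK by apply: sym_connect_sym; apply: relK_sym.
move=> /(sp_sum0 (P := P)) H.
have {}H : \sum_(y | P y) (del (h a) + del (h b)) y = 0.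
  apply: H => e eK; have /eqP/cards2P[u [v [uv euv]]] := K2 eK.
  rewrite euv evec2 //.
  rewrite (eq_bigr (fun y => del (h u) y + del (h v) y)) => [|y _]; last by rewrite ffunE.
  rewrite big_split !sum_del !PE.
  have /same_connect_r -> : connect relK u v by apply: connect1; rewrite /relK -euv.
    by apply/val_inj; case: connect.
  exact: cs.
move: H; rewrite (eq_bigr (fun y => del (h a) y + del (h b) y)) => [|y _]; last by rewrite ffunE.
by rewrite big_split !sum_del !PE connect0; case: connect.
Qed.

End Relation.

(** The rest of the cycle links the ends of its first edge, which is therefore in the span of the
    other edges. *)
Lemma cycle_dep (K : {set {set T}}) (G : graph T) p :
    (forall e, e \in K -> #|e| = 2) -> is_cycle G p ->
  (forall u, u \in p -> [set u; next p u] \in K) -> ~~ indep evec K.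
Proof.
move=> K2 /andP[sp2 /andP[_ up]] Kp.
have: cycle (relK K) p by apply: cycle_from_next.
case: p sp2 up {Kp} => [|a [|b [|c q]]] //= _.
rewrite !inE !negb_or => /and3P[/and3P[ab ac aq] /andP[bc bq] _].
case/and3P=> abK bcK cq; apply/negP => iK.
have := indep_notin iK abK; rewrite evec2 // => /negP; apply.
have K2' e : e \in K :\ [set a; b] -> #|e| = 2 by rewrite inE => /andP[_ /K2].
(* Each other edge of the cycle has an end outside [a] and [b], so it survives the removal of
   [[set a; b]]. *)
have ne (y z : T) : y \notin [set a; b] -> [set y; z] != [set a; b].
  by apply: contraNneq => <-; rewrite !inE eqxx.
rewrite addrC.
have bc' : relK (K :\ [set a; b]) b c.
  by rewrite /relK !inE [_ \in K]bcK andbT setUC ne // !inE negb_or eq_sym ac eq_sym bc.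
apply: link_trans (relK_link K2' bc') _.
suff cp : path (relK (K :\ [set a; b])) c (rcons q a).
  by have := path_link K2' cp; rewrite last_rcons.
have : a \notin c :: q by rewrite inE negb_or ac.
have : b \notin c :: q by rewrite inE negb_or bc.
elim: q c cq {bc aq bq ac bcK bc'} => [|d q IH] c /=.
  rewrite !inE => /andP[ca _] bc ac; rewrite /relK !inE [_ \in K]ca !andbT ne //.
  by rewrite !inE negb_or eq_sym ac eq_sym.
case/andP=> cd dq; rewrite in_cons negb_or => /andP[bc bq].
rewrite in_cons negb_or => /andP[ac aq].
apply/andP; split; last exact: IH.
rewrite /relK !inE [_ \in K]cd andbT ne //.
by rewrite !inE negb_or eq_sym ac eq_sym.
Qed.

(** An edge in the span of the others has its ends joined by a path avoiding it; the edge closes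
    this path to a cycle. *)
Lemma dep_cycle (K : {set {set T}}) (G : graph T) :
    (forall e, e \in K -> #|e| = 2) -> K \subset eset G -> ~~ indep evec K ->
  exists2 p, is_cycle G p & forall u, u \in p -> [set u; next p u] \in K.
Proof.
move=> K2 KG /dependentP[e eK].
have K2' e' : e' \in K :\ e -> #|e'| = 2 by rewrite inE => /andP[_ /K2].
have /eqP/cards2P[u [v [uv euv]]] := K2 e eK.
rewrite {1}euv evec2 // => /(link_connect K2') /connectP[p0 p0p v0].
case/shortenP: p0p v0 => p pp up _ vp.
have KS : subrel (relK (K :\ e)) (relK K) by move=> a b; rewrite /relK inE => /andP[].
have cp : cycle (relK K) (u :: p).
  by rewrite /= rcons_path (sub_path KS) // /relK -vp setUC -euv.
exists (u :: p); last by move=> a; apply: (next_cycle cp).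
apply/andP; split.
  (* A path with a single edge would be the removed edge [e], so the cycle has at least three
     vertices. *)
  case: p pp vp {up cp} uv => [_ /= ->|a [|b p]] //=; first by rewrite eqxx.
  by rewrite andbT => uK va; move: uK; rewrite /relK !inE -va -euv eqxx.
rewrite /ucycleb up andbT; apply: sub_cycle cp => a b; exact: (subsetP KG).
Qed.

End Incidence.

(** * The Ramsey property as a count of edges against rank *)

Section Sparsity.
Variables (T T' : finType) (h : T -> T').
Hypothesis h_inj : injective h.
Implicit Types (G : graph T).
Local Notation dimE D := (\dim (sp (evec h) D)).

Lemma edge_card G e : e \in eset G -> #|e| = 2.
Proof.
by move=> eG; have /subsetP/(_ e eG) := esetP G; rewrite !inE => /andP[_ /eqP].
Qed.

(** A cycle missing colour [i] is a dependency among the edges not coloured [i]; conversely, such a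
    dependency yields a cycle. *)
Lemma in_R_colourable r G : in_R r G <-> ~ colourable (evec h) r (eset G).
Proof.
have K2 (f : {set T} -> 'I_r.+1) i e : e \in [set e in eset G | f e != i] -> #|e| = 2.
  by rewrite inE => /andP[/edge_card].
split=> [GR [f Hf]|nc f].
  have [p cp pr] := GR f.
  have [i ip] : exists i, i \notin cycle_colours f p.
    apply/existsP; rewrite -negb_forall; apply: contraL pr => /forallP H.
    rewrite -ltnNge (_ : cycle_colours f p = setT) ?cardsT ?card_ord //.
    by apply/setP => i; rewrite H inE.
  move: (Hf i); apply/negP; apply: (cycle_dep h (K2 f i) cp).
  move=> u up; rewrite inE; apply/andP; split.
    by case/andP: cp => _ /andP[cp _]; apply: next_cycle cp up.
  by apply: contra ip => /eqP <-; apply: imset_f.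
have [/forallP H|] := boolP [forall i, indep (evec h) [set e in eset G | f e != i]].
  by case: nc; exists f.
rewrite negb_forall => /existsP[i /(dep_cycle h_inj (K2 f i) (G := G))[]].
  by apply/subsetP => e; rewrite inE => /andP[].
move=> p cp Hp; exists p => //.
have /subset_leq_card : cycle_colours f p \subset [set~ i].
  by apply/subsetP => _ /imsetP[u /Hp + ->]; rewrite !inE => /andP[].
by rewrite cardsC1 card_ord.
Qed.

Lemma in_RP r G : in_R r G <->
  exists2 D : {set {set T}}, D \subset eset G & r.+1 * dimE D < r * #|D|.
Proof.
rewrite in_R_colourable colourableP; split=> [H|[D DG lt] /(_ D DG)]; last by rewrite leqNgt lt.
apply/exists_inP; apply: contraT; rewrite negb_exists_in => /forall_inP H'.
by case: H => D /H'; rewrite -leqNgt.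
Qed.

(** A proper edge subset violating the bound would, with all vertices kept, form a proper subgraph
    in [in_R r]. *)
Lemma in_M_count r G : in_M r G ->
  (forall D : {set {set T}}, D \proper eset G -> r * #|D| <= r.+1 * dimE D)
  /\ r.+1 * dimE (eset G) < r * #|eset G|.
Proof.
case=> GR Gmin.
have P (D : {set {set T}}) : D \proper eset G -> r * #|D| <= r.+1 * dimE D.
  move=> /andP[DG GD]; have DP := subset_trans DG (esetP G).
  rewrite leqNgt; apply/negP => lt; case: (Gmin (Graph DP)).
    by rewrite /proper_subgraph /subgraph /= subxx DG GD.
  by apply/in_RP; exists D.
split=> //; have /in_RP[D DG lt] := GR.
have [<- //|ne] := eqVneq D (eset G).
by have := P D; rewrite properEneq ne DG leqNgt lt => /(_ isT).
Qed.

End Sparsity.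

(** * The rank of a connected graph *)

Section Del.
Variables (T : finType).
Local Open Scope ring_scope.

Lemma indep_del (V : {set T}) : indep (@del T) V.
Proof.
apply: contraT => /dependentP[v vV /(sp_sum0 (P := pred1 v))].
rewrite sum_del /= eqxx => H; suff : 1 = 0 :> 'F_2 by [].
apply: H => u; rewrite !inE => /andP[uv _].
by rewrite sum_del /= (negbTE uv).
Qed.

(** Adding [del v0] to the span yields every [del v] with [v] in [V]. This raises the dimension by
    one, since vectors in the span have coordinate sum 0. *)
Lemma dim_linked (S : finType) (vec : S -> {ffun T -> ('F_2)^o}) (A : {set S})
    (V : {set T}) v0 :
    v0 \in V ->
    (forall e, e \in A -> exists a b, [/\ a \in V, b \in V & vec e = del a + del b]) ->
    (forall v, v \in V -> del v0 + del v \in sp vec A) ->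
  #|V| = (\dim (sp vec A)).+1.
Proof.
move=> v0V AV VA; rewrite -(eqP (indep_del V)) -(@dim_addv_line _ _ _ (del v0)).
  congr (\dim _); apply/eqP; rewrite eqEsubv subv_add -memvE (mem_sp _ v0V) /=.
  apply/andP; split; apply/sp_subP => e.
    move=> /VA H; rewrite -[del e](add0r) -(addF2 (del v0)) -addrA.
    by apply: memv_add => //; apply: memv_line.
  by case/AV => a [b [aV bV ->]]; apply: memvD; apply: mem_sp.
apply/negP => /(sp_sum0 (P := predT)); rewrite sum_del /= => H.
suff : 1 = 0 :> 'F_2 by [].
apply: H => e /AV[a [b [_ _ ->]]].
rewrite (eq_bigr (fun y => del a y + del b y)) => [|y _]; last by rewrite ffunE.
by rewrite big_split !sum_del; apply/val_inj.
Qed.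

End Del.

(** * The blow-up and its new cycle *)

Lemma modnD_neq n i k : i < n -> 0 < k -> k < n -> i != (i + k) %% n.
Proof.
move=> ltin k0 kn; rewrite -[X in X != _](modn_small ltin) -{1}[i]addn0.
by rewrite eqn_modDl mod0n modn_small // eq_sym -lt0n.
Qed.

Section Counting.
Variables (r : nat) (hr : 2 <= r) (T : finType) (G : graph T) (x : T).
Hypothesis xG : x \in vset G.
Variable att : T -> 'I_r.+1.
Local Notation V' := (T + 'I_r.+1)%type.
Local Notation G' := (blowup G x att).

(* [G] is drawn in the vertex set of [G'] with [inr ord0] in the place of [x], so
   that the spans of both edge sets live in the same space. *)
Definition relabel (y : T) : V' := if y == x then inr ord0 else inl y.

Lemma relabel_inj : injective relabel.
Proof.
by move=> y z; rewrite /relabel; case: eqP => [->|_]; case: eqP => [->|_] // -[].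
Qed.

Definition contract (v : V') : T := if v is inl y then y else x.

Definition cedge (i : 'I_r.+1) : {set V'} := [set inr i; inr (ordS i)].
Definition cedges : {set {set V'}} := [set cedge i | i in 'I_r.+1].
Definition gedges : {set {set V'}} :=
  [set [set inl u | u in e] | e : {set T} in eset G & x \notin e]
  :|: [set [set inl y; inr (att y)] | y : T & adj G x y].

Local Notation spG := (sp (evec relabel)).
Local Notation spG' := (sp (evec (@id V'))).

Lemma ordS_neq (i : 'I_r.+1) : i != ordS i.
Proof.
apply/eqP => /(congr1 val) /= /eqP; rewrite -[i.+1]addn1; apply/negP.
by apply: modnD_neq => //; apply: ltnW.
Qed.

Lemma eset_blowup : eset G' = gedges :|: cedges.
Proof.
rewrite /= /blowup_eset; congr (_ :|: _); apply/setP => e.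
by apply/imsetP/imsetP => -[i _ ->]; exists i; rewrite ?inE ?ordS_neq.
Qed.

Lemma cedge_inj : injective cedge.
Proof.
move=> i j ij; have := set21 (inr i : V') (inr (ordS i)).
have := set22 (inr i : V') (inr (ordS i)); rewrite -!/(cedge _) ij !inE.
have E (a b : 'I_r.+1) : (inr a == inr b :> V') = (a == b) by [].
rewrite !E => /orP[/eqP Sij|/eqP /ordS_inj //] /orP[/eqP //|/eqP iSj].
(* Equal edges with their ends exchanged would give i = i + 2 modulo [r.+1], impossible for r at
   least 2. *)
have := congr1 val iSj; rewrite -Sij /= => /eqP.
rewrite -[(_ %% _).+1]addn1 modnDml addn1 -[i.+2]addn2.
by rewrite (negbTE (modnD_neq _ _ _)).
Qed.

Lemma card_cedges : #|cedges| = r.+1.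
Proof. by rewrite card_imset ?card_ord //; apply: cedge_inj. Qed.

Lemma evec_cedge i :
  evec id (cedge i) = (del (inr i : V') + del (inr (ordS i)))%R.
Proof. by rewrite evec2 // (inj_eq (@inr_inj _ _)) ordS_neq. Qed.

Lemma cedge_link i : (del (inr ord0) + del (inr i : V'))%R \in spG' cedges.
Proof.
case: i => n; elim: n => [|n IH] nr.
  by rewrite (_ : Ordinal nr = ord0) ?addF2 ?mem0v //; apply/val_inj.
have nr' := ltnW nr; apply: link_trans (IH nr') _.
rewrite (_ : Ordinal nr = ordS (Ordinal nr')); last first.
  by apply/val_inj; rewrite /= modn_small.
by rewrite -evec_cedge mem_sp // imset_f.
Qed.

Lemma dim_cedges : \dim (spG' cedges) = r.
Proof.
apply/eq_add_S; rewrite -(@dim_linked _ _ _ cedges (inr @: 'I_r.+1) (inr ord0 : V')).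
- by rewrite card_imset ?card_ord //; apply: inr_inj.
- exact: imset_f.
- move=> _ /imsetP[i _ ->]; exists (inr i), (inr (ordS i)).
  by rewrite !imset_f // evec_cedge.
- by move=> _ /imsetP[i _ ->]; apply: cedge_link.
Qed.

(** All edge vectors of the cycle sum to 0, so dropping one edge keeps the span; the other [r] edges
    thus have rank [r]. *)
Lemma indep_cedges (D : {set {set V'}}) : D \proper cedges -> indep (evec id) D.
Proof.
case/properP=> DC [_ /imsetP[i _ ->] iD].
apply: (@indepS _ _ _ _ _ (cedges :\ cedge i)).
  apply/subsetP => e eD; rewrite inE (subsetP DC) // andbT inE.
  by apply: contraNneq iD => <-.
rewrite /indep; have := cardsD1 (cedge i) cedges.
rewrite card_cedges imset_f // add1n => -[<-]; rewrite -[in X in _ == X]dim_cedges.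
apply/eqP; congr (\dim _); apply/eqP; rewrite eqEsubv spS ?subD1set //=.
apply/sp_subP => _ /imsetP[j _ ->].
have [->|ij] := eqVneq j i; last first.
  by apply: mem_sp; rewrite !inE (inj_eq cedge_inj) ij imset_f.
have sum0 : (\sum_i evec id (cedge i) = 0 :> {ffun V' -> ('F_2)^o})%R.
  rewrite (eq_bigr _ (fun i _ => evec_cedge i)) big_split /=.
  by rewrite [X in (X + _)%R](reindex_inj (@ordS_inj _)) /= addF2.
move: sum0; rewrite (bigD1 i) //= => /(congr1 (+%R (evec id (cedge i)))).
rewrite addrA addF2 add0r addr0 => <-.
apply: memv_suml => k ki; apply: mem_sp.
by rewrite !inE (inj_eq cedge_inj) ki imset_f.
Qed.

Lemma gedges_sub : gedges \subset eset G'.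
Proof. by rewrite eset_blowup subsetUl. Qed.

Lemma cedges_sub : cedges \subset eset G'.
Proof. by rewrite eset_blowup subsetUr. Qed.

Definition contract_edge (e : {set V'}) : {set T} := [set contract v | v in e].

Lemma contract_inl (e : {set T}) : contract_edge [set inl u | u in e] = e.
Proof. by rewrite /contract_edge -imset_comp -[RHS]imset_id; apply: eq_imset. Qed.

Lemma contract_pair y i : contract_edge [set inl y; inr i] = [set x; y].
Proof. by rewrite /contract_edge imsetU !imset_set1 setUC. Qed.

Lemma adj_neq y : adj G x y -> x != y.
Proof. by move/edge_card; rewrite cards2; case: eqP. Qed.

Lemma gedges_cases e : e \in gedges ->
  (exists e0 : {set T}, [/\ e0 \in eset G, x \notin e0 & e = [set inl u | u in e0]])
  \/ (exists y, adj G x y /\ e = [set inl y; inr (att y)]).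
Proof.
rewrite inE => /orP[] /imsetP[].
  by move=> e0; rewrite inE => /andP[e0G xe] ->; left; exists e0.
by move=> y; rewrite inE => xy ->; right; exists y.
Qed.

Lemma contract_gedges : contract_edge @: gedges = eset G.
Proof.
apply/setP => e; apply/imsetP/idP => [[e' /gedges_cases[[e0 [e0G _ ->]]|[y [xy ->]]] ->]|eG].
- by rewrite contract_inl.
- by rewrite contract_pair.
have [xe|xe] := boolP (x \in e); last first.
  exists [set inl u | u in e]; last by rewrite contract_inl.
  by rewrite inE; apply/orP; left; apply: imset_f; rewrite inE eG.
have [y exy] : exists y, e = [set x; y].
  have /eqP/cards2P[a [b [_ eab]]] := edge_card eG.
  by move: xe; rewrite eab !inE => /orP[] /eqP ->; [exists b|exists a; rewrite setUC].
exists [set inl y; inr (att y)]; last by rewrite contract_pair.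
by rewrite inE; apply/orP; right; apply: imset_f; rewrite inE /adj -exy.
Qed.

(** An edge avoiding [x] is unchanged, and the edge from [x] to [y] has a single counterpart, ending
    at [att y]. *)
Lemma contract_edge_inj : {in gedges &, injective contract_edge}.
Proof.
move=> e e' /gedges_cases[[e0 [_ xe0 ->]]|[y [xy ->]]] /gedges_cases[[e1 [_ xe1 ->]]|[z [xz ->]]].
- by rewrite !contract_inl => ->.
- by rewrite contract_inl contract_pair => H; rewrite H !inE eqxx in xe0.
- by rewrite contract_inl contract_pair => H; rewrite -H !inE eqxx in xe1.
rewrite !contract_pair => /setP/(_ y); rewrite !inE eqxx orbT eq_sym.
by rewrite (negbTE (adj_neq xy)) => /esym/eqP ->.
Qed.

Lemma gedges_cedges e : e \in gedges -> e \notin cedges.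
Proof.
move=> eG; have := imset_f contract_edge eG; rewrite contract_gedges => /edge_card e2.
apply/negP => /imsetP[i _ ei]; move: e2.
by rewrite ei /contract_edge imsetU !imset_set1 setUid cards1.
Qed.

(** Modulo the span of the cycle, its vertices all agree with [inr ord0], which stands for [x]. *)
Lemma gedge_link e : e \in gedges ->
  (evec id e + evec relabel (contract_edge e))%R \in spG' cedges.
Proof.
case/gedges_cases=> [[e0 [_ xe0 ->]]|[y [xy ->]]].
  rewrite contract_inl [X in (X + _)%R](_ : _ = evec relabel e0) ?addF2 ?mem0v //.
  rewrite /evec big_imset /=; last by move=> ? ? _ _ [].
  by apply: eq_bigr => u ue; rewrite /relabel; case: eqP ue xe0 => // -> ->.
rewrite contract_pair !evec2 ?adj_neq // /relabel eqxx.
rewrite eq_sym (negbTE (adj_neq xy)) addrC -addrA [X in (_ + X)%R]addrA addF2 add0r.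
exact: cedge_link.
Qed.

(** * Rank under contraction of the new cycle *)

Section Contraction.
Variable D : {set {set V'}}.
Hypothesis DG : D \subset eset G'.
Let B := contract_edge @: (D :&: gedges).

Lemma contract_subset : B \subset eset G.
Proof. by rewrite -contract_gedges imsetS // subsetIr. Qed.

Lemma card_contract : #|D| = #|B| + #|D :&: cedges|.
Proof.
rewrite card_in_imset; last first.
  move=> e e' /setIP[_ eG] /setIP[_ eG']; exact: contract_edge_inj.
rewrite -(cardsID gedges D); congr (_ + _); apply: eq_card => e.
rewrite in_setD in_setI; case eD: (e \in D); rewrite ?andbF //= andbT.
have := subsetP DG e eD; rewrite eset_blowup in_setU.
case: (boolP (e \in gedges)) => [/gedges_cedges/negbTE ->|_ /= ->] //.
Qed.

Lemma span_contract : (spG' D + spG' cedges = spG B + spG' cedges)%VS.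
Proof.
have gl e : e \in D -> e \in gedges -> (contract_edge e \in B) *
    ((evec id e + evec relabel (contract_edge e))%R \in spG' cedges).
  by move=> eD eG; split; [rewrite imset_f // inE eD|apply: gedge_link].
apply/eqP; rewrite eqEsubv !subv_add !addvSr !andbT; apply/andP; split; apply/sp_subP.
  move=> e eD; have := subsetP DG e eD; rewrite eset_blowup inE => /orP[eG|eC].
    have [eB H] := gl e eD eG; have := memv_add (mem_sp (evec relabel) eB) H.
    by rewrite addrC -addrA addF2 addr0.
  exact: subvP (addvSr _ _) _ (mem_sp _ eC).
move=> _ /imsetP[e /setIP[eD eG] ->]; have [_ H] := gl e eD eG.
by have := memv_add (mem_sp (evec id) eD) H; rewrite addrA addF2 add0r.
Qed.

(** A common vector is supported on the cycle and, coming from [G], only on [inr ord0] there; its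
    coordinates sum to 0, so it vanishes. *)
Lemma span_disjoint : (spG B :&: spG' cedges = 0)%VS.
Proof.
apply/eqP; rewrite -subv0; apply/subvP => w; rewrite memv_cap memv0 => /andP[wB wC].
have wl y : w (inl y) = 0%R.
  have := sp_sum0 (P := pred1 (inl y : V')) _ wC; rewrite big_pred1_eq; apply.
  move=> _ /imsetP[i _ ->]; rewrite evec_cedge big_pred1_eq !ffunE.
  by apply/val_inj.
have wr i : i != ord0 -> w (inr i) = 0%R.
  move=> i0; have := sp_sum0 (P := pred1 (inr i : V')) _ wB; rewrite big_pred1_eq; apply.
  move=> e eB; rewrite big_pred1_eq sum_ffunE big1 // => u _.
  rewrite ffunE /relabel; case: (u == x) => //.
  by rewrite (inj_eq (@inr_inj _ _)) (negbTE i0).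
have : (\sum_(v : V') w v = 0)%R.
  apply: (sp_sum0 (P := predT)) wC => _ /imsetP[i _ ->]; rewrite evec_cedge.
  under eq_bigr do rewrite ffunE.
  by rewrite big_split !sum_del; apply/val_inj.
rewrite (bigD1 (inr ord0)) //= big1 ?addr0 => [w0|[y|i] //= i0]; last exact: wr.
apply/eqP/ffunP => -[y|i]; rewrite ffunE ?wl //.
by have [->|/wr] := eqVneq i ord0.
Qed.

Lemma dim_contract : \dim (spG' D + spG' cedges) = \dim (spG B) + r.
Proof. by rewrite span_contract dimv_disjoint_sum ?span_disjoint // dim_cedges. Qed.

End Contraction.


(** * Edge counts and minimality of the blow-up *)

Section Main.
Hypotheses (GM : in_M r G) (rv : r %| #|vset G|) (G'2 : k_connected 2 G').

Lemma blowup_connect u v : u \in vset G' -> v \in vset G' -> connect (adj G') u v.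
Proof.
have [_ /(_ set0)] := G'2; rewrite cards0 => /(_ isT)[_].
rewrite [vset _](setD0 (vset G')) => H uG vG.
apply: connect_sub (H u v uG vG) => a b ab.
by apply: connect1; move: ab; rewrite /adj inE => /andP[].
Qed.

Lemma inl_vset y : y \in vset G -> y != x -> inl y \in vset G'.
Proof. by move=> yG yx; rewrite in_setU imset_f // in_setD1 yx. Qed.

Lemma inr_vset i : inr i \in vset G'.
Proof. by rewrite in_setU orbC imset_f // inE. Qed.

(* Removing [inr i] leaves [inl y] connected to the rest of the cycle; stop at the
   first cycle vertex met. *)
Lemma escape y i : y \in vset G -> y != x ->
  exists2 j, j != i & (del (inl y : V') + del (inr j))%R \in spG' gedges.
Proof.
move=> yG yx; have [_ /(_ [set inr i])] := G'2; rewrite cards1 => /(_ isT)[_ H].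
have yV : inl y \in vset (del_vertices G' [set inr i]).
  by rewrite in_setD inl_vset // andbT !inE.
have kV : inr (ordS i) \in vset (del_vertices G' [set inr i]).
  by rewrite in_setD inr_vset andbT inE (inj_eq (@inr_inj _ _)) eq_sym ordS_neq.
have /connectP[p pp pl] := H _ _ yV kV.
have : (del (inl y : V') + del (inl y))%R \in spG' gedges by rewrite addF2 mem0v.
(* Along the path, [inl y] stays linked to the current vertex [inl z], which only edges of [gedges]
   can leave. *)
move: pp pl; move: {1 2 4}y; elim: p => [|v p IH] z //= /andP[zv pp] pl yz.
have {zv} [zvi zvG] : inr i \notin [set inl z; v] /\ [set inl z; v] \in gedges.
  move: zv; rewrite /adj inE => /andP[zvG /subsetP sub]; split.
    by apply/negP => /sub; rewrite !inE eqxx.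
  move: zvG; rewrite eset_blowup in_setU => /orP[//|/imsetP[k _ /setP/(_ (inl z))]].
  by rewrite !inE eqxx.
have K2 e : e \in gedges -> #|e| = 2 by move/(subsetP gedges_sub)/edge_card.
have zvE := link_trans yz (relK_link id K2 zvG).
case: v zvi zvE pp pl {zvG} => [z'|j] /= zvi zvE pp pl; first exact: IH pp pl zvE.
by exists j => //; apply: contra zvi => /eqP ->; rewrite !inE eqxx orbT.
Qed.

Lemma card_vset_blowup : #|vset G'| = #|vset G| + r.
Proof.
rewrite /= /blowup_vset cardsU (_ : _ :&: _ = set0) ?cards0 ?subn0; last first.
  apply/setP => v; rewrite !inE; apply/negP => /andP[/imsetP[y _ ->]] /imsetP[i _].
  by [].
rewrite !card_imset ?cardsT ?card_ord; [|exact: inr_inj|exact: inl_inj].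
by rewrite [in RHS](cardsD1 x) xG; lia.
Qed.

Local Notation dG := (\dim (spG (eset G))).

Lemma dim_blowup : \dim (spG' (eset G')) = dG + r.
Proof.
have := dim_contract (subxx (eset G')).
rewrite (_ : eset G' :&: gedges = gedges); last first.
  by apply/setIidPr; rewrite gedges_sub.
rewrite contract_gedges -spU (_ : eset G' :|: cedges = eset G') //.
by apply/setUidPl; rewrite cedges_sub.
Qed.

(** Connectedness is at hand for the blow-up, so its vertices are counted and [r] is cancelled. *)
Lemma card_vset : #|vset G| = dG.+1.
Proof.
have v0 := inr_vset ord0.
have := @dim_linked _ _ (evec id) (eset G') (vset G') _ v0.
rewrite card_vset_blowup dim_blowup => H; apply: (@addIn r); rewrite addSn H //.
  move=> e eG; have /eqP/cards2P[a [b [ab eab]]] := edge_card eG.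
  exists a, b; rewrite eab evec2 //; have := subsetP (esetP G') e eG.
  by rewrite inE => /andP[+ _]; rewrite inE eab subUset !sub1set => /andP[].
move=> v vG; have /connectP[p pp ->] := blowup_connect v0 vG.
exact: path_link (fun e => @edge_card _ G' e) _ _ pp.
Qed.

Lemma excess_one : r * #|eset G| = r.+1 * dG + 1.
Proof.
have [P lt] := in_M_count relabel_inj GM.
have /card_gt0P[e eG] : 0 < #|eset G| by move: lt; case: #|eset G| => //; rewrite muln0.
have := P (eset G :\ e); rewrite properD1 // => /(_ isT) le.
have {}le : r * #|eset G :\ e| <= r.+1 * dG.
  by apply: leq_trans le _; rewrite leq_mul2l dimvS ?orbT // spS ?subD1set.
have := cardsD1 e (eset G); rewrite eG add1n => cE.
have /dvdnP[k] := rv; rewrite card_vset => dk.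
move: lt le; rewrite cE; set d := dG in dk *; set n := #|_ :\ _| => lt le.
(* As [r] divides [d.+1], the left side is a multiple of [r]. It and [r * n.+1] both lie among the
   [r] integers following [r.+1 * d], so they agree. *)
have e1 : r.+1 * d + 1 = r * (d + k) by rewrite mulSn mulnDr [r * k]mulnC -dk; lia.
have : d + k <= n.+1 by rewrite -(@leq_pmul2l r) -?e1; lia.
have : n < d + k by rewrite -(@ltn_pmul2l r) -?e1; lia.
by move=> l1 l2; rewrite e1; congr (_ * _); lia.
Qed.

Lemma gedges_meet_cedges : 0 < \dim (spG' gedges :&: spG' cedges).
Proof.
have [_ lt] := in_M_count relabel_inj GM.
have /card_gt0P[e eG] : 0 < #|eset G| by move: lt; case: #|eset G| => //; rewrite muln0.
have [y yG yx] : exists2 y, y \in vset G & y != x.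
  have /eqP/cards2P[a [b [ab eab]]] := edge_card eG.
  have := subsetP (esetP G) e eG; rewrite inE => /andP[+ _].
  rewrite inE eab subUset !sub1set => /andP[aG bG].
  by have [ax|ax] := eqVneq a x; [exists b; rewrite // -ax eq_sym|exists a].
(* The second escape avoids [j], so [y] is linked to two distinct cycle vertices, which are also
   linked along the cycle. *)
have [j _ yj] := escape ord0 yG yx; have [k kj yk] := escape j yG yx.
rewrite lt0n dimv_eq0; apply/eqP => I0.
have : (del (inr j : V') + del (inr k))%R \in (spG' gedges :&: spG' cedges)%VS.
  rewrite memv_cap; apply/andP; split.
    by apply: link_trans yk; rewrite addrC.
  by apply: link_trans (cedge_link k); rewrite addrC cedge_link.
rewrite I0 memv0 => /eqP/ffunP/(_ (inr j)); rewrite !ffunE eqxx.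
by rewrite (inj_eq (@inr_inj _ _)) eq_sym (negbTE kj).
Qed.

Lemma proper_bound (D : {set {set V'}}) :
  D \proper eset G' -> r * #|D| <= r.+1 * \dim (spG' D).
Proof.
case/andP=> DG GD; have [P _] := in_M_count relabel_inj GM.
have BE := contract_subset D; have cD := card_contract DG; have dD := dim_contract DG.
move: BE cD dD; set B := contract_edge @: _ => BE cD dD.
have [CD|CD] := boolP (cedges \subset D).
  have BP : B \proper eset G.
    rewrite properEneq BE andbT; apply: contra GD => /eqP BG.
    rewrite eset_blowup subUset CD andbT.
    suff /eqP <- : D :&: gedges == gedges by apply: subsetIl.
    rewrite eqEcard subsetIr /= -(card_in_imset contract_edge_inj) contract_gedges.
    by rewrite -BG leq_imset_card.
  have := P B BP; move: dD cD.
  rewrite -spU (setUidPl CD) (setIidPr CD) card_cedges => -> ->.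
  by rewrite !mulnDr (mulnC r r.+1) leq_add2r.
have CDP : D :&: cedges \proper cedges.
  by rewrite properEneq subsetIr andbT; apply: contra CD => /eqP <-; apply: subsetIl.
have := dimv_sum_cap (spG' D) (spG' cedges); rewrite dD dim_cedges => dD'.
(* By [dD'], this intersection has as dimension the gain in rank of [D] over [B]; a proper part of
   the cycle, being independent, bounds it below. *)
have capD : #|D :&: cedges| <= \dim (spG' D :&: spG' cedges).
  rewrite -(eqP (indep_cedges CDP)); apply: dimvS.
  by rewrite subv_cap !spS ?subsetIl ?subsetIr.
have dge : \dim (spG B) + #|D :&: cedges| <= \dim (spG' D).
  by rewrite -(leq_add2r r) -dD' addnAC leq_add2l.
rewrite cD mulnDr; have [BG|nBG] := eqVneq B (eset G); last first.
  have := P B; rewrite properEneq nBG BE => /(_ isT) PB.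
  apply: leq_trans (leq_mul (leqnn _) dge).
  by rewrite mulnDr leq_add // leq_mul2r leqnSn orbT.
(* Now [B] exceeds its bound by one. A cycle edge in [D] makes up for it, adding [r] on the left and
   [r.+1] on the right. *)
have := excess_one; rewrite -BG => ->.
have [D0|c0] := posnP #|D :&: cedges|; last first.
  apply: leq_trans (leq_mul (leqnn _) dge).
  by rewrite mulnDr -addnA leq_add2l mulSn leq_add2r.
(* Without cycle edges, [D] is all of [gedges]; its span meets that of the cycle, so its rank
   exceeds that of [B]. *)
have DE : D = gedges.
  have DS : D \subset gedges.
    apply/subsetP => e eD; have := subsetP DG e eD.
    rewrite eset_blowup in_setU => /orP[//|eC].
    by have /setP/(_ e) := cards0_eq D0; rewrite !inE eD eC.
  apply/eqP; rewrite eqEcard DS -(card_in_imset contract_edge_inj) contract_gedges.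
  by rewrite -BG cD D0 addn0 /=.
have cap0 := gedges_meet_cedges; rewrite -DE in cap0.
rewrite D0 muln0 addn0; apply: (@leq_trans (r.+1 * (\dim (spG B)).+1)).
  by rewrite mulnSr leq_add2l.
by rewrite leq_mul2l /= -(leq_add2r r) -dD' addSn -addn1 leq_add2l.
Qed.

Lemma blowup_in_M : in_M r G'.
Proof.
split=> [|H /andP[/andP[HV HE] nGH] /(in_RP (@inj_id V'))[D DH lt]].
  apply/(in_RP (@inj_id V')); exists (eset G') => //.
  have := card_contract (subxx (eset G')); rewrite dim_blowup.
  rewrite (_ : eset G' :&: gedges = gedges); last first.
    by apply/setIidPr; rewrite gedges_sub.
  rewrite (_ : eset G' :&: cedges = cedges); last first.
    by apply/setIidPr; rewrite cedges_sub.
  rewrite contract_gedges card_cedges => ->.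
  by rewrite !mulnDr excess_one (mulnC r r.+1) addnAC addn1.
have [DE|nDE] := eqVneq D (eset G'); last first.
  have := @proper_bound D; rewrite properEneq nDE (subset_trans DH HE).
  by rewrite leqNgt lt => /(_ isT).
rewrite DE in DH; case/negP: nGH; rewrite /subgraph DH andbT.
(* [H] has every edge of the blow-up, and by connectedness every vertex lies on one, so [H] is not
   proper. *)
apply/subsetP => z zG; have [G'3 _] := G'2.
have /card_gt0P[u] : 0 < #|vset G' :\ z| by move: G'3; rewrite (cardsD1 z) zG; lia.
rewrite in_setD1 => /andP[uz uG]; have /connectP[[|a p]] := blowup_connect zG uG.
  by move=> _ /= uz'; rewrite uz' eqxx in uz.
case/andP=> /(subsetP DH) za _ _; have := subsetP (esetP H) _ za.
by rewrite !inE subUset sub1set => /andP[/andP[]].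
Qed.

End Main.
End Counting.

Theorem theorem1p10 (r : nat) (hr : 2 <= r) (T : finType) (G : graph T)
    (hG : in_M r G) (hdvd : r %| #|vset G|)
    (x : T) (hx : x \in vset G) (att : T -> 'I_r.+1)
    (hconn : k_connected 2 (blowup G x att)) :
  in_M r (blowup G x att).
Proof. exact: blowup_in_M. Qed.
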